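(* Let $K$ be a field, let $k,\ell,d$ be integers with $2\le k\le \ell\le d$, and let $J_{\Delta}\subset R$ be the ideal defined in the context. Then the number of minimal prime components of $\sqrt{J_{\Delta}}$ is $\ell^{k}-\ell+1$.
   Context: Let $K$ be a field and $2\le k\le\ell\le d$ integers. Let $P=(p_{x,y})_{x\in[d],\,y\in[k\ell]}$ be a $d\times k\ell$ matrix of indeterminates and $R=K[P]$. For $A\subseteq[d]$, $B\subseteq[k\ell]$ with $|A|=|B|$, $[A|B]$ denotes the determinant of the submatrix of $P$ with rows indexed by $A$ and columns indexed by $B$ (in increasing order). Put $C_j=\{(j-1)k+i: i\in[k]\}$ for $j\in[\ell]$ and $R_i=\{(j-1)k+i: j\in[\ell]\}$ for $i\in[k]$. Then $J_{\Delta}=\langle [A|B] : A\subseteq[d],\ |A|=|B|,\ B\in\Delta\rangle$, where $\Delta=\bigcup_{j\in[\ell]}\{B\subseteq C_j: |B|=2\}\ \cup\ \{R_1,\dots,R_k\}$ (so the generators are the $2$-minors of $P$ with both columns in one $C_j$ and the $\ell$-minors of $P$ with column set some $R_i$). *)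

(* Defs.v *)
From mathcomp Require Import all_boot all_algebra.
From mathcomp Require Import mpoly.
From mathcomp Require Import boolp classical_sets functions cardinality.

Set Implicit Arguments.
Unset Strict Implicit.
Unset Printing Implicit Defensive.

Import GRing.Theory.
Local Open Scope ring_scope.

Section Ideals.
Variable A : comNzRingType.
Implicit Types I p q : set A.

Definition ideal_gen (G : set A) : set A :=
  [set f | exists (n : nat) (c g : 'I_n -> A),
     (forall i, G (g i)) /\ f = \sum_(i < n) c i * g i].

Definition radical I : set A := [set f | exists n : nat, I (f ^+ n)].

(* [idealr_closed] already includes [1 \notin p]. *)
Definition prime_ideal p : Prop := idealr_closed (mem p) /\ prime_idealr_closed (mem p).

Definition minimal_primes I : set (set A) :=
  [set p | [/\ prime_ideal p, (I `<=` p)%classic &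
     forall q, prime_ideal q -> (I `<=` q)%classic -> (q `<=` p)%classic -> q = p]].

End Ideals.

Section Hypergraph.
Variables (K : fieldType) (k l d : nat).

Definition generic_mx : 'M[{mpoly K[d * (k * l)]}]_(d, k * l) :=
  \matrix_(x < d, y < k * l) 'X_(mxvec_index x y).

(* [A|B]: [enum_val] lists the elements of a set of ordinals in increasing order. *)
Definition minor (S : comNzRingType) (m n : nat) (M : 'M[S]_(m, n))
    (A : {set 'I_m}) (B : {set 'I_n}) (eqAB : #|A| = #|B|) : S :=
  \det (mxsub (fun i : 'I_#|A| => enum_val i)
              (fun j : 'I_#|A| => enum_val (cast_ord eqAB j)) M).

(* Indices are 0-based, so column (j-1)k+i of the 1-based convention is
   column j*k+i here. *)
Definition colC (j : 'I_l) : {set 'I_(k * l)} :=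
  [set y : 'I_(k * l) | [exists i : 'I_k, (y : nat) == (j * k + i)%N]].

Definition rowR (i : 'I_k) : {set 'I_(k * l)} :=
  [set y : 'I_(k * l) | [exists j : 'I_l, (y : nat) == (j * k + i)%N]].

Definition Delta : {set {set 'I_(k * l)}} :=
  (\bigcup_(j < l) [set B : {set 'I_(k * l)} | (B \subset colC j) && (#|B| == 2%N)])
    :|: [set rowR i | i : 'I_k].

Definition J_Delta : set {mpoly K[d * (k * l)]} :=
  ideal_gen [set f | exists (A : {set 'I_d}) (B : {set 'I_(k * l)})
    (eqAB : #|A| = #|B|), B \in Delta /\ f = minor generic_mx eqAB].

End Hypergraph.

Arguments J_Delta : clear implicits.

(* Main.v *)
From HB Require Import structures.
Require Import Defs.
From mathcomp Require Import all_boot all_algebra.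
From mathcomp Require Import mpoly.
From mathcomp Require Import boolp classical_sets functions cardinality.
From mathcomp Require Import ring_quotient fraction ring.

(** Write [v_(j,i)] for column [j * k + i] of a matrix [M] with entries in a
    field.  The ideal vanishes at [M] exactly when the columns [v_(j,1)], ...,
    [v_(j,k)] of each block [j] are pairwise parallel and, for each position
    [i], the columns [v_(1,i)], ..., [v_(l,i)] are linearly dependent
    ([mx_eval_J_Delta], [J_Delta_dependent]).  The first condition says
    [v_(j,i) = a_(j,i) w_j].  If [w_1, ..., w_l] are dependent, the second
    condition is automatic.  If they are independent, it says that every
    position [i] has a block [f i] with [a_(f i, i) = 0], and [f] cannot be
    constant, since a block all of whose coefficients vanish can be given the
    vector [0] ([dependent_comp_point]).  So the zero locus is the union of the
    locus [None] of dependent [w_j] and of the loci [Some f] given by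
    [v_(f i, i) = 0], one for each of the [l ^ k - l] nonconstant maps [f] from
    positions to blocks ([card_admissible]).

    Each locus is the image of an affine space.  The vectors are the columns of
    [U *m pid_mx r *m V], where [r] is [l.-1] for [None] and [l] for [Some f],
    and the coefficients prescribed to vanish are masked.  Over an arbitrary,
    possibly finite, field the locus is represented by the kernel of evaluation
    at the point with indeterminate parameters; it is prime because polynomials
    form a domain ([component_prime]).  A prime [q] containing the ideal is the
    kernel of a morphism [phi] to a field ([prime_ideal_kernel]), and the image
    under [phi] of the generic matrix satisfies the two conditions above, so it
    is a specialization of one of the generic points; hence the corresponding
    kernel lies in [q] ([component_below]).

    Distinct components are incomparable ([component_antichain]): the entries
    masked for [f] vanish on [Some f] and not all of them vanish on another
    component, while a maximal minor that picks in each block [j] a column at a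
    position [s j] with [f (s j) <> j] vanishes on [None] but not on [Some f].
    The components are therefore the minimal primes. *)

Set Implicit Arguments.
Unset Strict Implicit.
Unset Printing Implicit Defensive.

Import GRing.Theory.
Local Open Scope ring_scope.

(** * Prime ideals as kernels of morphisms to fields *)

Lemma prime_idealM (A : comNzRingType) (p : set A) :
  prime_ideal p -> forall u v, p (u * v) -> p u \/ p v.
Proof.
move=> [_ pP] u v /mem_set puv.
by have /orP[/set_mem|/set_mem] := pP u v puv; [left|right].
Qed.

Lemma kernel_prime_ideal (A : comNzRingType) (D : idomainType)
  (phi : {rmorphism A -> D}) : prime_ideal [set u | phi u = 0]%classic.
Proof.
split; [split=> [||a u v]|move=> u v]; rewrite ?in_setE /=.
- by rewrite rmorph0.
- by apply/negP; rewrite in_setE /= rmorph1 => /eqP; rewrite oner_eq0.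
- by move=> phiu phiv; rewrite rmorphD rmorphM phiu phiv mulr0 addr0.
- rewrite rmorphM => /eqP; rewrite mulf_eq0.
  by case/orP=> /eqP phi0; apply/orP; [left|right]; rewrite in_setE.
Qed.

Section FractionFieldOfDomain.
Variables (A : comNzRingType) (domA : GRing.integral_domain_axiom A).

Definition dom_unit : {pred A} := [pred x | `[< exists y, y * x = 1 >]].
Definition dom_inv (x : A) : A :=
  if pselect (exists y, y * x = 1) is left xy then sval (cid xy) else x.

Fact dom_mulVx : {in dom_unit, left_inverse 1 dom_inv *%R}.
Proof.
move=> x; rewrite unfold_in => /asboolP ux; rewrite /dom_inv.
by case: pselect => [xy|//]; apply: (svalP (cid xy)).
Qed.
Fact dom_unitPl x y : y * x = 1 -> dom_unit x.
Proof. by move=> yx; apply/asboolP; exists y. Qed.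
Fact dom_invr_out : {in [predC dom_unit], dom_inv =1 id}.
Proof.
move=> x; rewrite inE unfold_in => /asboolPn ux; rewrite /dom_inv.
by case: pselect.
Qed.

(** A copy of [A], so that the classical inverse can be made canonical without
    touching the instances of [A] itself. *)
Definition domain_of : Type := A.
HB.instance Definition _ := GRing.ComNzRing.on domain_of.
HB.instance Definition _ := GRing.ComNzRing_hasMulInverse.Build domain_of
  dom_mulVx dom_unitPl dom_invr_out.
HB.instance Definition _ := GRing.ComUnitRing_isIntegral.Build domain_of domA.

Lemma domain_embeds_in_field :
  exists (L : fieldType) (phi : {rmorphism A -> L}), forall u, phi u = 0 -> u = 0.
Proof.
exists {fraction domain_of}, (@tofrac domain_of : {rmorphism domain_of -> _}) => u /eqP.
by rewrite tofrac_eq0 => /eqP.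
Qed.
End FractionFieldOfDomain.

(** The field is the fraction field of the quotient by [q].  This turns a
    statement about primes into linear algebra over a field. *)
Lemma prime_ideal_kernel (A : comNzRingType) (q : set A) : prime_ideal q ->
  exists (L : fieldType) (phi : {rmorphism A -> L}), q = [set u | phi u = 0]%classic.
Proof.
move=> [qI qP].
pose I0 : {pred A} := fun x => x \in q.
pose mI := isIdealr.Build A I0 qI.
pose mP := isPrimeIdealrClosed.Build A I0 qP.
pose I : prime_idealr A := HB.pack I0 mI mP.
have [L [phi phi_inj]] := @domain_embeds_in_field {ideal_quot I}
  (@Quotient.rquot_IdomainAxiom A I).
have pi0 (u : A) : ((\pi u)%qT == 0 :> {ideal_quot I}) = (u \in q).
  by rewrite -(raddf0 (\pi_({ideal_quot I})%qT)) -Quotient.idealrBE subr0.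
exists L, (phi \o \pi_({ideal_quot I})%qT)%FUN; apply/seteqP; split=> u /=.
  by move=> /mem_set; rewrite -pi0 => /eqP ->; rewrite rmorph0.
by move=> /phi_inj/eqP; rewrite pi0 in_setE.
Qed.

(** * Minimal primes from an antichain of primes *)

Lemma prime_ideal_radical (A : comNzRingType) (I q : set A) :
  prime_ideal q -> (I `<=` q)%classic -> (radical I `<=` q)%classic.
Proof.
move=> q_prime Iq u [n /Iq]; elim: n => [|n IHn]; last first.
  by rewrite exprS => /(prime_idealM q_prime)[].
by rewrite expr0 => q1; case: q_prime => [[_ /negP[]]]; rewrite in_setE.
Qed.

(** Every prime above [I] lies above some [P c], so only members of the family
    can be minimal, and the antichain condition makes each of them minimal. *)
Lemma minimal_primes_radical_range (A : comNzRingType) (I : set A)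
    (C : Type) (P : C -> set A) :
    (forall c, prime_ideal (P c)) -> (forall c, (I `<=` P c)%classic) ->
    (forall q, prime_ideal q -> (I `<=` q)%classic ->
       exists c, (P c `<=` q)%classic) ->
    (forall c c', (P c `<=` P c')%classic -> c = c') ->
  minimal_primes (radical I) = range P.
Proof.
move=> P_prime IP P_below P_antichain.
have I_rad : (I `<=` radical I)%classic by move=> u Iu; exists 1%N.
apply/seteqP; split=> [q [q_prime rad_q q_min]|_ [c _ <-]].
  have [c Pcq] := P_below q q_prime (subset_trans I_rad rad_q).
  exists c => //; apply: q_min => //.
  by apply: prime_ideal_radical.
split=> // [|q q_prime rad_q qPc]; first exact: prime_ideal_radical.
have [c' Pc'q] := P_below q q_prime (subset_trans I_rad rad_q).
have cc' : c' = c by apply: P_antichain; apply: subset_trans qPc.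
by apply/seteqP; split=> //; rewrite -cc'.
Qed.

Lemma card_range_fin (C : finType) (T : Type) (P : C -> T) :
  injective P -> (range P #= `I_#|C|)%card.
Proof.
move=> P_inj; apply: (card_eq_trans (inj_card_eq _)); first exact: in2W.
apply/card_set_bijP; exists (fun c => val (enum_rank c)); split=> [c _|c c' _ _|i].
- exact: ltn_ord.
- by move=> /val_inj/enum_rank_inj.
- by move=> i_lt; exists (enum_val (Ordinal i_lt)); rewrite ?enum_valK.
Qed.

(** * Minors and linear dependence of columns *)

(** The coefficients are indexed by all columns rather than by an enumeration of
    [B], which keeps enumerations of subsets out of the later arguments. *)
Definition columns_dependent (S : comNzRingType) (m n : nat) (M : 'M[S]_(m, n))
    (B : {set 'I_n}) : Prop :=
  exists2 c : 'I_n -> S, (exists2 y, y \in B & c y != 0) &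
    forall x, \sum_(y in B) c y * M x y = 0.

(** The minors are determinants of matrices that are square only up to a
    propositional equality of their dimensions. *)
Lemma det_colsub_cast_eq0 (D : idomainType) (m n : nat) (e : m = n)
    (X : 'M[D]_(m, n)) :
  (\det (colsub (cast_ord e) X) == 0) <-> exists2 v : 'cV_n, v != 0 & X *m v = 0.
Proof.
case: n / e X => X; have -> : colsub (cast_ord erefl) X = X.
  by apply/matrixP=> i j; rewrite mxE cast_ord_id.
rewrite -det_tr; split=> [/det0P[v v_neq0 vX]|[v v_neq0 Xv]].
  by exists v^T; rewrite ?trmx_eq0 // -(trmxK X) -trmx_mul vX trmx0.
by apply/det0P; exists v^T; rewrite ?trmx_eq0 // -trmx_mul Xv trmx0.
Qed.

Section MinorsAndDependency.
Variables m n : nat.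

Lemma columns_dependentP (S : comNzRingType) (M : 'M[S]_(m, n)) (B : {set 'I_n}) :
  columns_dependent M B <-> exists2 v : 'cV[S]_#|B|, v != 0 &
    colsub (fun t : 'I_#|B| => enum_val t) M *m v = 0.
Proof.
split=> [[c [y By cy] cM]|[v /eqP v_neq0 Mv]].
  exists (\col_t c (enum_val t)).
    apply: contra_neq cy => /matrixP/(_ (enum_rank_in By y) 0).
    by rewrite !mxE enum_rankK_in.
  apply/matrixP=> x j; rewrite !mxE -[RHS](cM x) [RHS]big_enum_val.
  by apply: eq_bigr => t _; rewrite !mxE mulrC.
have [t vt] : exists t, v t 0 != 0.
  apply: contrapT => /forallNP v0; apply: v_neq0; apply/matrixP=> t j.
  by rewrite ord1 mxE; apply/eqP/negPn/negP/v0.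
have Bt := enum_valP t.
exists (fun y => v (enum_rank_in Bt y) 0).
  by exists (enum_val t) => //; rewrite enum_valK_in.
move=> x; move/matrixP/(_ x 0): Mv; rewrite !mxE => Mvx; rewrite -[RHS]Mvx.
by rewrite big_enum_val; apply: eq_bigr => s _; rewrite !mxE enum_valK_in mulrC.
Qed.

Lemma minorE (S : comNzRingType) (M : 'M[S]_(m, n)) (A : {set 'I_m})
    (B : {set 'I_n}) (eAB : #|A| = #|B|) :
  minor M eAB = \det (colsub (cast_ord eAB)
    (rowsub (fun s : 'I_#|A| => enum_val s) (colsub (fun t : 'I_#|B| => enum_val t) M))).
Proof. by congr (\det _); apply/matrixP=> s t; rewrite !mxE. Qed.

(** Stated over a domain so that it applies directly to polynomial entries. *)
Lemma minor_dependent (D : idomainType) (M : 'M[D]_(m, n)) (A : {set 'I_m})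
    (B : {set 'I_n}) (eAB : #|A| = #|B|) :
  columns_dependent M B -> minor M eAB = 0.
Proof.
move=> /columns_dependentP[v v_neq0 Mv]; apply/eqP; rewrite minorE.
apply/det_colsub_cast_eq0; exists v => //.
by rewrite mul_rowsub_mx Mv; apply/matrixP=> s j; rewrite !mxE.
Qed.

(** Independent columns have full rank, so some choice of rows gives an invertible
    square submatrix.  That choice [f] need not be increasing; its image [A] still
    gives a nonzero minor, because a vector killed by the rows in [A] is killed by
    the rows [f t]. *)
Lemma dependent_of_minors (L : fieldType) (M : 'M[L]_(m, n)) (B : {set 'I_n}) :
    (forall (A : {set 'I_m}) (eAB : #|A| = #|B|), minor M eAB = 0) ->
  columns_dependent M B.
Proof.
move=> minors0; apply/columns_dependentP; apply: contrapT => M_indep.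
set N := colsub _ _ in M_indep.
have N_full : row_full N.
  rewrite -col_leq_rank leqNgt; apply/negP => N_small; apply: M_indep.
  have : kermx N^T != 0.
    by rewrite kermx_eq0 /row_free mxrank_tr neq_ltn N_small.
  case/rowV0Pn => v /sub_kermxP vN v_neq0.
  by exists v^T; rewrite ?trmx_eq0 // -(trmxK N) -trmx_mul vN trmx0.
pose f := fullrankfun N_full.
pose A := [set f t | t in [set: 'I_#|B|]].
have eAB : #|A| = #|B|.
  by rewrite card_imset ?cardsT ?card_ord //; apply: fullrankfun_inj.
move/eqP: (minors0 A eAB); rewrite minorE => /det_colsub_cast_eq0[v v_neq0 NAv].
move/negP: v_neq0; apply; apply/eqP.
have /row_full_inj : row_full (rowsub f N) := fullrowsub_full N_full.
apply; rewrite mulmx0; apply/matrixP=> t j; rewrite [RHS]mxE.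
have At : f t \in A by apply: imset_f.
rewrite mul_rowsub_mx [LHS]mxE -(enum_rankK_in At At).
by move/matrixP/(_ (enum_rank_in At (f t)) j): NAv; rewrite mul_rowsub_mx mxE [RHS]mxE.
Qed.
End MinorsAndDependency.

(** * Blocks and positions of columns *)

Section Grid.
Variables k l : nat.

Fact cell_subproof (j : 'I_l) (i : 'I_k) : (j * k + i < k * l)%N.
Proof.
apply: (@leq_trans (j * k + k)); first by rewrite ltn_add2l.
by rewrite -mulSnr mulnC leq_mul2l ltn_ord orbT.
Qed.
Definition cell (j : 'I_l) (i : 'I_k) : 'I_(k * l) := Ordinal (cell_subproof j i).

Fact cell_block_subproof (y : 'I_(k * l)) : (y %/ k < l)%N.
Proof.
have /andP[k_gt0 _] : (0 < k)%N && (0 < l)%N.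
  by rewrite -muln_gt0; apply: leq_ltn_trans (ltn_ord y).
by rewrite ltn_divLR // [X in (_ < X)%N]mulnC.
Qed.
Definition cell_block (y : 'I_(k * l)) : 'I_l := Ordinal (cell_block_subproof y).

Fact cell_pos_subproof (y : 'I_(k * l)) : (y %% k < k)%N.
Proof.
have /andP[k_gt0 _] : (0 < k)%N && (0 < l)%N.
  by rewrite -muln_gt0; apply: leq_ltn_trans (ltn_ord y).
by rewrite ltn_pmod.
Qed.
Definition cell_pos (y : 'I_(k * l)) : 'I_k := Ordinal (cell_pos_subproof y).

Lemma cell_blockK j i : cell_block (cell j i) = j.
Proof.
apply: val_inj => /=; rewrite divnMDl ?divn_small ?addn0 //.
exact: leq_ltn_trans (ltn_ord i).
Qed.

Lemma cell_posK j i : cell_pos (cell j i) = i.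
Proof. by apply: val_inj; rewrite /= modnMDl modn_small. Qed.

Lemma cellK y : cell (cell_block y) (cell_pos y) = y.
Proof. by apply: val_inj; rewrite /= -divn_eq. Qed.

Lemma in_colC (j : 'I_l) y : (y \in colC k j) = (cell_block y == j).
Proof.
rewrite inE; apply/existsP/eqP => [[i /eqP yE]|<-].
  by rewrite -[RHS](cell_blockK j i); congr cell_block; apply: val_inj.
by exists (cell_pos y); apply/eqP; exact: (divn_eq y k).
Qed.

Lemma in_rowR (i : 'I_k) y : (y \in rowR l i) = (cell_pos y == i).
Proof.
rewrite inE; apply/existsP/eqP => [[j /eqP yE]|<-].
  by rewrite -[RHS](cell_posK j i); congr cell_pos; apply: val_inj.
by exists (cell_block y); apply/eqP; exact: (divn_eq y k).
Qed.

Lemma sum_rowR (S : nmodType) (i : 'I_k) (F : 'I_(k * l) -> S) :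
  \sum_(y in rowR l i) F y = \sum_j F (cell j i).
Proof.
rewrite (reindex_onto (cell^~ i) cell_block) /=; last first.
  by move=> y; rewrite in_rowR => /eqP <-; rewrite cellK.
by apply: eq_bigl => j; rewrite in_rowR cell_posK cell_blockK !eqxx.
Qed.

Lemma Delta_pair (j : 'I_l) (i i' : 'I_k) : i != i' ->
  [set cell j i; cell j i'] \in Delta k l.
Proof.
move=> ii'; rewrite inE; apply/orP; left; apply/bigcupP; exists j => //.
rewrite inE cards2 (contra_neq _ ii') ?andbT; last first.
  by move=> /(congr1 cell_pos); rewrite !cell_posK.
by apply/fintype.subsetP => y /set2P[] ->; rewrite in_colC cell_blockK.
Qed.

Lemma Delta_rowR (i : 'I_k) : rowR l i \in Delta k l.
Proof. by rewrite inE imset_f ?orbT. Qed.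

Lemma DeltaP (B : {set 'I_(k * l)}) : B \in Delta k l ->
  (exists j i i', i != i' /\ B = [set cell j i; cell j i']) \/
  (exists i, B = rowR l i).
Proof.
rewrite inE => /orP[/bigcupP[j _]|/imsetP[i _ ->]]; last by right; exists i.
rewrite inE => /andP[/fintype.subsetP BC /cards2P[y [y' [yy' BE]]]].
left; move: BC; rewrite BE => BC.
have /eqP yj : cell_block y == j by rewrite -in_colC BC // !inE eqxx.
have /eqP y'j : cell_block y' == j by rewrite -in_colC BC // !inE eqxx orbT.
exists j, (cell_pos y), (cell_pos y'); split; last first.
  by rewrite -{1}yj -y'j !cellK.
by apply: contra_neq yy' => pyy'; rewrite -(cellK y) -(cellK y') yj y'j pyy'.
Qed.
End Grid.

(** * Evaluation of polynomials at matrices *)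

Section Evaluation.
Variables (K : fieldType) (d n : nat).

Definition mx_eval (S : comNzRingType) (iota : {rmorphism K -> S}) (M : 'M[S]_(d, n)) :
  {rmorphism {mpoly K[d * n]} -> S} := mmap iota (mxvec M 0).

Lemma mx_evalX (S : comNzRingType) (iota : {rmorphism K -> S}) (M : 'M[S]_(d, n)) x y :
  mx_eval iota M 'X_(mxvec_index x y) = M x y.
Proof. by rewrite /= mmapX mmap1U mxvecE. Qed.

Lemma mx_eval_morph (S T : comNzRingType) (iota : {rmorphism K -> S})
    (theta : {rmorphism S -> T}) (M : 'M[S]_(d, n)) u :
  theta (mx_eval iota M u) = mx_eval (theta \o iota) (map_mx theta M) u.
Proof.
rewrite /= /mmap rmorph_sum; apply: eq_bigr => m _ /=; rewrite rmorphM /mmap1 rmorph_prod.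
congr (_ * _); apply: eq_bigr => i _.
by case/mxvec_indexP: i => x y; rewrite rmorphXn !mxvecE mxE.
Qed.

(** Every morphism out of the polynomial ring is evaluation at the image of the
    generic matrix. *)
Lemma rmorph_mx_eval (S : comNzRingType) (phi : {rmorphism {mpoly K[d * n]} -> S}) u :
  phi u = mx_eval (phi \o mpolyC (d * n) (R := K))
                  (\matrix_(x, y) phi 'X_(mxvec_index x y)) u.
Proof.
rewrite {1}[u]mpolyE rmorph_sum /= /mmap; apply: eq_bigr => m _ /=.
rewrite -mul_mpolyC rmorphM; congr (_ * _).
rewrite mpolyXE_id rmorph_prod /mmap1; apply: eq_bigr => i _.
by case/mxvec_indexP: i => x y; rewrite rmorphXn mxvecE mxE.
Qed.

End Evaluation.

(** * The zero locus of the ideal *)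

Section VanishingLocus.
Variables (K : fieldType) (k l d : nat).

Lemma mx_eval_minor (S : comNzRingType) (iota : {rmorphism K -> S})
    (M : 'M[S]_(d, k * l)) (A : {set 'I_d}) (B : {set 'I_(k * l)}) (eAB : #|A| = #|B|) :
  mx_eval iota M (minor (generic_mx K k l d) eAB) = minor M eAB.
Proof.
rewrite /minor -det_map_mx; congr (\det _); apply/matrixP=> s t.
by rewrite !mxE mx_evalX.
Qed.

Lemma mx_eval_J_Delta (D : idomainType) (iota : {rmorphism K -> D})
    (M : 'M[D]_(d, k * l)) :
    (forall B, B \in Delta k l -> columns_dependent M B) ->
  forall u, J_Delta K k l d u -> mx_eval iota M u = 0.
Proof.
move=> M_dep u [n [c [g [gens ->]]]]; rewrite rmorph_sum big1 // => i _.
have [A [B [eAB [BD ->]]]] := gens i.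
by rewrite rmorphM mx_eval_minor minor_dependent ?mulr0 //; apply: M_dep.
Qed.

Lemma J_Delta_dependent (L : fieldType) (iota : {rmorphism K -> L})
    (M : 'M[L]_(d, k * l)) :
    (forall u, J_Delta K k l d u -> mx_eval iota M u = 0) ->
  forall B, B \in Delta k l -> columns_dependent M B.
Proof.
move=> M_J B BD; apply: dependent_of_minors => A eAB.
rewrite -(mx_eval_minor iota); apply: M_J.
exists 1%N, (fun=> 1), (fun=> minor (generic_mx K k l d) eAB); split.
  by move=> _; exists A, B, eAB.
by rewrite big_ord1 mul1r.
Qed.

End VanishingLocus.

(** * Parametrized components *)

Lemma det_pid_pred (D : comNzRingType) (n : nat) : (0 < n)%N ->
  \det (pid_mx n.-1 : 'M[D]_n) = 0.
Proof.
case: n => // n _; rewrite det_trig.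
  by rewrite (bigD1 ord_max) //= mxE eqxx ltnn mul0r.
apply/is_trig_mxP => s t st; rewrite mxE.
by case: eqP => // e; rewrite e ltnn in st.
Qed.

(** Constant maps are excluded: their locus has a zero block, hence is contained
    in that of [None]. *)
Definition admissible (k l : nat) (c : option {ffun 'I_k -> 'I_l}) : bool :=
  if c is Some f then [forall j, exists i, f i != j] else true.

Section Parametrization.
Variables (k l d : nat).
Implicit Type c : option {ffun 'I_k -> 'I_l}.

(** [None] stands for the locus where the block vectors are dependent, [Some f]
    for the locus where column [i] of block [f i] vanishes for every [i]. *)
Definition comp_rank c : nat := if c is Some _ then l else l.-1.
Definition comp_mask c (j : 'I_l) (i : 'I_k) : bool :=
  if c is Some f then f i != j else true.

Section OverRing.
Variable S : comNzRingType.
Implicit Types (a : 'M[S]_(l, k)) (U : 'M[S]_(d, l)) (V : 'M[S]_l).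

(** A product through [pid_mx r] with generic factors has rank at most [r], and
    over a field every matrix of rank at most [r] has this form; this treats both
    kinds of components at once. *)
Definition comp_vectors c U V : 'M[S]_(d, l) := U *m pid_mx (comp_rank c) *m V.

Definition comp_coef c a (j : 'I_l) (i : 'I_k) : S := a j i *+ comp_mask c j i.

Definition comp_point c a U V : 'M[S]_(d, k * l) :=
  \matrix_(x, y) (comp_coef c a (cell_block y) (cell_pos y)
                  * comp_vectors c U V x (cell_block y)).

Lemma comp_point_cell c a U V x j i :
  comp_point c a U V x (cell j i) = comp_coef c a j i * comp_vectors c U V x j.
Proof. by rewrite mxE cell_blockK cell_posK. Qed.
End OverRing.

Lemma map_comp_point (S T : comNzRingType) (theta : {rmorphism S -> T}) c a U V :
  map_mx theta (comp_point c a U V) =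
    comp_point c (map_mx theta a) (map_mx theta U) (map_mx theta V).
Proof.
apply/matrixP=> x y; rewrite mxE [X in theta X]mxE [RHS]mxE rmorphM rmorphMn.
congr (_ * _); first by rewrite /comp_coef mxE.
by rewrite /comp_vectors -(map_pid_mx theta) -!map_mxM [RHS]mxE.
Qed.

(** The relation [b' v - b v' = 0] is trivial when [b] and [b'] both vanish; the
    first case uses instead that [b = 0] makes the first column zero. *)
Lemma columns_dependent2 (S : comNzRingType) (m n : nat) (M : 'M[S]_(m, n)) y y'
    (b b' : S) (w : 'I_m -> S) :
    y != y' -> (forall x, M x y = b * w x) -> (forall x, M x y' = b' * w x) ->
  columns_dependent M [set y; y'].
Proof.
move=> yy' My My'; have [b0|b_neq0] := eqVneq b 0.
  exists (fun z => (z == y)%:R).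
    by exists y; rewrite ?set21 ?eqxx ?oner_eq0.
  move=> x; rewrite big_setU1 ?inE //= big_set1 eqxx [y' == y]eq_sym (negbTE yy').
  by rewrite My b0 !mul0r mulr0 addr0.
exists (fun z => if z == y then b' else - b).
  by exists y'; rewrite ?set22 // [y' == y]eq_sym (negbTE yy') oppr_eq0.
move=> x; rewrite big_setU1 ?inE //= big_set1 eqxx [y' == y]eq_sym (negbTE yy').
by rewrite My My'; ring.
Qed.

(** For a fixed position the columns form [U *m N], with [N] square of size [l].
    The determinant of [N] vanishes: for [None] because of the factor
    [pid_mx l.-1], for [Some f] because the diagonal factor has a masked entry.
    Over a domain a singular [N] kills a nonzero vector. *)
Lemma comp_point_dependent (D : idomainType) c (a : 'M[D]_(l, k)) U V :
    (0 < l)%N -> forall B, B \in Delta k l ->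
  columns_dependent (comp_point c a U V) B.
Proof.
move=> l_gt0 B /DeltaP[[j [i [i' [ii' ->]]]]|[i ->]].
  apply: (@columns_dependent2 _ _ _ _ _ _ (comp_coef c a j i) (comp_coef c a j i')
    (fun x => comp_vectors c U V x j)) => [|x|x]; rewrite ?comp_point_cell //.
  by apply: contra_neq ii' => /(congr1 (@cell_pos k l)); rewrite !cell_posK.
pose N : 'M_l := pid_mx (comp_rank c) *m V *m diag_mx (\row_j comp_coef c a j i).
have /det0P[v v_neq0 vN] : \det N^T == 0.
  rewrite det_tr !det_mulmx det_diag; apply/eqP.
  case: c @N => [f|] N /=.
    by rewrite (bigD1 (f i)) //= mxE /comp_coef /= eqxx mul0r mulr0.
  by rewrite det_pid_pred // !mul0r.
have Nv : N *m v^T = 0 by rewrite -(trmxK N) -trmx_mul vN trmx0.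
have [j vj] : exists j, v 0 j != 0.
  apply: contrapT => /forallNP v0; move/eqP: v_neq0; apply; apply/rowP=> j.
  by rewrite mxE; apply/eqP/negPn/negP/v0.
exists (fun y => v 0 (cell_block y)).
  by exists (cell j i); rewrite ?in_rowR ?cell_posK ?cell_blockK.
move=> x; rewrite sum_rowR; have /matrixP/(_ x 0) : U *m (N *m v^T) = 0.
  by rewrite Nv mulmx0.
rewrite [RHS]mxE => UNv; rewrite -[RHS]UNv !mulmxA mxE; apply: eq_bigr => t _.
rewrite comp_point_cell cell_blockK mul_mx_diag [X in _ = X * _]mxE [v^T _ _]mxE
  [X in _ * X * _]mxE.
by rewrite -/(comp_vectors c U V); ring.
Qed.

End Parametrization.

(** * Classification of the points of the zero locus *)

Section Classification.
Variables (L : fieldType) (k l d : nat).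

Lemma pid_factorization (W : 'M[L]_(d, l)) (r : nat) : (\rank W <= r <= l)%N ->
  exists U V, W = U *m (pid_mx r : 'M_l) *m V.
Proof.
move=> /andP[Wr rl]; exists (col_ebase W *m pid_mx (\rank W)), (row_ebase W).
rewrite -[LHS]mulmx_ebase; congr (_ *m _); rewrite -mulmxA mul_pid_mx.
by rewrite (minn_idPl Wr) (minn_idPr (leq_trans Wr rl)).
Qed.

Lemma columns_dependent2_cross (n : nat) (M : 'M[L]_(d, n)) y y' :
    y != y' -> columns_dependent M [set y; y'] ->
  forall x x', M x y * M x' y' = M x y' * M x' y.
Proof.
move=> yy' [c cy cM] x x'.
have cMz z : c y * M z y + c y' * M z y' = 0.
  by rewrite -[RHS](cM z) big_setU1 ?inE //= big_set1.
apply/eqP; rewrite -subr_eq0.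
case: cy => z /set2P[] -> c_neq0; rewrite -(mulrI_eq0 _ (mulfI c_neq0)).
  have -> : c y * (M x y * M x' y' - M x y' * M x' y) =
    (c y * M x y + c y' * M x y') * M x' y' -
    M x y' * (c y * M x' y + c y' * M x' y') by ring.
  by rewrite !cMz mul0r mulr0 subr0.
have -> : c y' * (M x y * M x' y' - M x y' * M x' y) =
  M x y * (c y * M x' y + c y' * M x' y') -
  (c y * M x y + c y' * M x y') * M x' y by ring.
by rewrite !cMz mul0r mulr0 subr0.
Qed.

Variable M : 'M[L]_(d, k * l).
Hypothesis M_dep : forall B, B \in Delta k l -> columns_dependent M B.

(** A nonzero block is spanned by any of its nonzero columns.  The second clause
    normalizes the vector of a zero block to [0]; it is what rules out constant
    maps in [dependent_comp_point]. *)
Lemma block_rank1 (j : 'I_l) : exists aw : ('I_k -> L) * ('I_d -> L),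
  (forall x i, M x (cell j i) = aw.1 i * aw.2 x) /\
  ((forall i, aw.1 i = 0) -> forall x, aw.2 x = 0).
Proof.
have [[[x0 i0] M0]|M0] := pselect (exists xi, M xi.1 (cell j xi.2) != 0); last first.
  exists (fun=> 0, fun=> 0); split=> //= x i; rewrite mul0r; apply/eqP/negPn/negP => Mx.
  by apply: M0; exists (x, i).
rewrite /= in M0.
exists (fun i => M x0 (cell j i) / M x0 (cell j i0), fun x => M x (cell j i0)).
split=> [x i|/(_ i0)/eqP] /=; last by rewrite divff // oner_eq0.
rewrite mulrAC; apply: canRL (mulfK M0) _.
have [->|ii0] := eqVneq i i0; first by rewrite mulrC.
rewrite [RHS]mulrC; apply: columns_dependent2_cross; last exact/M_dep/Delta_pair.
by apply: contra_neq ii0 => /(congr1 (@cell_pos k l)); rewrite !cell_posK.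
Qed.

(** Let [W] have the block vectors as columns.  If [W] has rank less than [l] the
    point lies on [None].  Otherwise a relation among the columns at position [i]
    reads [W *m (c_j a_(j,i))_j = 0], whence [a_(j,i) = 0] whenever [c_j] is
    nonzero, and [f i] is such a [j].  If [f] were constantly [j], the vector of
    block [j] would be zero, against the rank of [W]. *)
Lemma dependent_comp_point : (0 < l)%N ->
  exists c (a : 'M[L]_(l, k)) U V, admissible c /\ M = comp_point c a U V.
Proof.
move=> l_gt0.
have /boolp.choice[aw awP] := block_rank1.
pose a := \matrix_(j < l, i < k) (aw j).1 i.
pose W := \matrix_(x < d, j < l) (aw j).2 x.
have M_aW x j i : M x (cell j i) = a j i * W x j by rewrite !mxE (awP j).1.
have M_point c U V : W = comp_vectors c U V ->
    (forall j i, a j i = comp_coef c a j i) -> M = comp_point c a U V.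
  move=> WE aE; apply/matrixP=> x y.
  by rewrite -(cellK y) comp_point_cell -aE -WE.
have [W_small|W_full] := ltnP (\rank W) l.
  have [|U [V WE]] := @pid_factorization W l.-1.
    by rewrite leq_pred andbT -ltnS prednK.
  by exists None, a, U, V; split=> //; apply: M_point.
have W_inj (v : 'cV_l) : W *m v = 0 -> v = 0.
  rewrite -(mulmx0 _ W); apply: row_full_inj.
  by rewrite /row_full eqn_leq rank_leq_col.
have [U [V WE]] : exists U V, W = U *m (pid_mx l : 'M_l) *m V.
  by apply: pid_factorization; rewrite rank_leq_col leqnn.
have zero_entry i : exists j, a j i = 0.
  have [c [y yR cy] cM] := M_dep (Delta_rowR l i).
  have /W_inj/matrixP ca : W *m (\col_j (c (cell j i) * a j i)) = 0.
    apply/matrixP=> x j0; rewrite mxE [RHS]mxE -[RHS](cM x) sum_rowR.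
    by apply: eq_bigr => j _; rewrite M_aW [X in _ * X]mxE; ring.
  move: yR; rewrite in_rowR => /eqP yi.
  exists (cell_block y); have /eqP := ca (cell_block y) 0.
  by rewrite !mxE -yi cellK mulf_eq0 (negbTE cy) => /eqP.
have /boolp.choice[f fP] := zero_entry.
exists (Some [ffun i => f i]), a, U, V; split.
  apply/forallP=> j; apply: contrapT => /negP; rewrite negb_exists => /forallP fj.
  have aj0 i : (aw j).1 i = 0.
    by move/negPn/eqP: (fj i); rewrite ffunE => <-; have := fP i; rewrite mxE.
  have /matrixP/(_ j 0)/eqP : delta_mx j 0 = 0 :> 'cV[L]_l.
    apply: W_inj; rewrite -colE; apply/matrixP=> x t; rewrite !mxE.
    exact: (awP j).2.
  by rewrite !mxE !eqxx oner_eq0.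
apply: M_point => // j i; rewrite /comp_coef /= ffunE.
by case: eqP => // <-; rewrite fP.
Qed.
End Classification.

(** * The components as prime ideals *)

Section Components.
Variables (K : fieldType) (k l d : nat).
Implicit Type c : option {ffun 'I_k -> 'I_l}.
Local Notation R := {mpoly K[d * (k * l)]}.

(** The index type of the indeterminates in the coefficients [a] and in the
    factors [U] and [V]. *)
Definition param : finType := ('I_l * 'I_k + 'I_d * 'I_l + 'I_l * 'I_l)%type.
Local Notation S := {mpoly K[#|{: param}|]}.

Definition generic_a : 'M[S]_(l, k) :=
  \matrix_(j, i) 'X_(enum_rank (inl (inl (j, i)) : param)).
Definition generic_U : 'M[S]_(d, l) :=
  \matrix_(x, t) 'X_(enum_rank (inl (inr (x, t)) : param)).
Definition generic_V : 'M[S]_l :=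
  \matrix_(t, j) 'X_(enum_rank (inr (t, j) : param)).

Definition generic_eval c : {rmorphism R -> S} :=
  mx_eval (mpolyC #|{: param}| (R := K)) (comp_point c generic_a generic_U generic_V).

(** The vanishing ideal of the parametrized locus, as the kernel of evaluation at
    the generic point; unlike the set of polynomials vanishing at the
    [K]-points, it is the right ideal also when [K] is finite. *)
Definition component c : set R := [set u | generic_eval c u = 0]%classic.

Lemma component_prime c : prime_ideal (component c).
Proof. exact: kernel_prime_ideal. Qed.

Lemma J_Delta_sub_component c : (0 < l)%N -> (J_Delta K k l d `<=` component c)%classic.
Proof. by move=> l_gt0; apply/mx_eval_J_Delta/comp_point_dependent. Qed.

(** A point with parameters in any [K]-algebra is a specialization of the generic
    point. *)
Lemma component_eval (D : comNzRingType) (iota : {rmorphism K -> D}) c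
    (a : 'M[D]_(l, k)) (U : 'M[D]_(d, l)) (V : 'M[D]_l) u :
  component c u -> mx_eval iota (comp_point c a U V) u = 0.
Proof.
pose h (t : param) : D := match t with
  | inl (inl ji) => a ji.1 ji.2 | inl (inr xt) => U xt.1 xt.2
  | inr tj => V tj.1 tj.2 end.
pose theta : {rmorphism S -> D} := mmap iota (fun t => h (enum_val t)).
have thetaX t : theta 'X_(enum_rank t) = h t.
  by rewrite /= mmapX mmap1U enum_rankK.
move=> u0; have := congr1 theta u0.
rewrite rmorph0 mx_eval_morph map_comp_point => {}u0; rewrite -[RHS]u0.
have -> : map_mx theta generic_a = a by apply/matrixP=> j i; rewrite !mxE thetaX.
have -> : map_mx theta generic_U = U by apply/matrixP=> x t; rewrite !mxE thetaX.
have -> : map_mx theta generic_V = V by apply/matrixP=> t j; rewrite !mxE thetaX.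
rewrite /= /mmap; apply: eq_bigr => m _; congr (_ * _).
exact/esym/mmapC.
Qed.

(** [q] is the kernel of evaluation at a matrix over a field on which the ideal
    vanishes; this matrix is a point of some component. *)
Lemma component_below (q : set R) : (0 < l)%N ->
    prime_ideal q -> (J_Delta K k l d `<=` q)%classic ->
  exists c, admissible c /\ (component c `<=` q)%classic.
Proof.
move=> l_gt0 /prime_ideal_kernel[L [phi ->]] Jphi.
pose iota : {rmorphism K -> L} := phi \o mpolyC (d * (k * l)) (R := K).
pose M := \matrix_(x < d, y < k * l) phi 'X_(mxvec_index x y).
have [] := @dependent_comp_point L k l d M _ l_gt0.
  by apply: (J_Delta_dependent (iota := iota)) => u /Jphi; rewrite /= rmorph_mx_eval.
move=> c [a [U [V [c_adm ME]]]]; exists c; split=> // u cu.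
by rewrite /= rmorph_mx_eval -/M ME; apply: component_eval.
Qed.

Lemma masked_entry_in_component c x j i : comp_mask c j i = false ->
  component c 'X_(mxvec_index x (cell j i)).
Proof.
by move=> mask0; rewrite /component /= mx_evalX comp_point_cell /comp_coef mask0 mul0r.
Qed.

(** The witness has all coefficients equal to [1], apart from the masked ones, and
    block vectors of rank one; [1 < l] makes rank one available on [None]. *)
Lemma masked_entry_notin_component c x j i : (1 < l)%N -> comp_mask c j i ->
  ~ component c 'X_(mxvec_index x (cell j i)).
Proof.
move=> l_gt1 mask1.
have [|U [V WE]] := @pid_factorization K l d (delta_mx x j) (comp_rank c).
  rewrite mxrank_delta; case: c {mask1} => [f|] /=; first by rewrite leqnn ltnW.
  by rewrite leq_pred andbT -ltnS prednK // ltnW.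
move=> /(component_eval idfun (const_mx 1) U V)/eqP.
rewrite mx_evalX comp_point_cell /comp_coef mask1 /comp_vectors -WE !mxE !eqxx.
by rewrite mulr1 oner_eq0.
Qed.

(** * Incomparability of the components *)

Definition transversal_minor (hld : (l <= d)%N) (s : 'I_l -> 'I_k) : R :=
  \det (mxsub (widen_ord hld) (fun j => cell j (s j)) (generic_mx K k l d)).

Lemma eval_transversal_minor (D : comNzRingType) (iota : {rmorphism K -> D}) hld s c
    (a : 'M[D]_(l, k)) (U : 'M[D]_(d, l)) (V : 'M[D]_l) :
  mx_eval iota (comp_point c a U V) (transversal_minor hld s) =
  \det (rowsub (widen_ord hld) (comp_vectors c U V)) * \prod_j comp_coef c a j (s j).
Proof.
have <- : \det (diag_mx (\row_j comp_coef c a j (s j))) = \prod_j comp_coef c a j (s j).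
  by rewrite det_diag; apply: eq_bigr => j _; rewrite mxE.
rewrite -det_mulmx -det_map_mx; congr (\det _); apply/matrixP=> t j.
by rewrite mul_mx_diag !mxE mx_evalX comp_point_cell mulrC mxE.
Qed.

Lemma transversal_minor_in_None hld s : (0 < l)%N ->
  component None (transversal_minor hld s).
Proof.
move=> l_gt0; rewrite /component /= eval_transversal_minor.
rewrite /comp_vectors -!mul_rowsub_mx !det_mulmx det_pid_pred //.
by rewrite mulr0 !mul0r.
Qed.

(** The witness is the point of [Some f] whose block vectors are the first [l] unit
    vectors and whose unmasked coefficients are [1]: since [s] avoids the masked
    coefficients, the chosen submatrix is the identity. *)
Lemma transversal_minor_notin_Some hld s (f : {ffun 'I_k -> 'I_l}) :
    (forall j, f (s j) != j) ->
  ~ component (Some f) (transversal_minor hld s).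
Proof.
move=> fs /(component_eval idfun (const_mx 1) (pid_mx l) 1%:M)/eqP.
rewrite eval_transversal_minor /comp_vectors /=.
rewrite big1 => [|j _]; last by rewrite /comp_coef /= fs mxE.
rewrite pid_mx_id // mulmx1 mulr1.
have -> : rowsub (widen_ord hld) (pid_mx l : 'M[K]_(d, l)) = 1%:M.
  by apply/matrixP=> t j; rewrite !mxE /= ltn_ord andbT.
by rewrite det1 oner_eq0.
Qed.

(** From [Some f] the inclusion forces every entry masked for [f] to be masked for
    [c'], which leaves only [c' = Some f].  From [None] to [Some f] it is refuted by a
    transversal minor avoiding the masked columns, which exists as [f] is not
    constant. *)
Lemma component_antichain c c' : (0 < k)%N -> (1 < l <= d)%N ->
    admissible c -> admissible c' -> (component c `<=` component c')%classic -> c = c'.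
Proof.
move=> k_gt0 /andP[l_gt1 hld].
have d_gt0 : (0 < d)%N by apply: leq_trans hld; apply: ltnW.
case: c => [f|] => f_adm c'_adm sub; last first.
  case: c' c'_adm sub => [f|//] /= f_nc sub.
  have /boolp.choice[s fs] : forall j, exists i, f i != j.
    by move=> j; apply/existsP/(forallP f_nc).
  case: (transversal_minor_notin_Some (hld := hld) fs).
  by apply/sub/transversal_minor_in_None/ltnW.
have entry i : comp_mask c' (f i) i = false.
  apply/negP => mask1.
  apply: (@masked_entry_notin_component c' (Ordinal d_gt0) (f i) i) => //.
  by apply/sub/masked_entry_in_component; rewrite /= eqxx.
case: c' {sub} c'_adm entry => [g|] _ entry.
  by congr Some; apply/ffunP => i; apply/esym/eqP/negbFE/entry.
by have := entry (Ordinal k_gt0).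
Qed.
End Components.

(** * The count *)

(** The maps that are not admissible are the [l] constant ones. *)
Lemma card_admissible (k l : nat) : (0 < k)%N ->
  #|{: {c : option {ffun 'I_k -> 'I_l} | admissible c}}| = (l ^ k - l + 1)%N.
Proof.
move=> k_gt0; rewrite card_sig.
have k_eq : k = k.-1.+1 by rewrite prednK.
pose cst (j : 'I_l) : option {ffun 'I_k -> 'I_l} := Some [ffun => j].
have cst_inj : injective cst.
  by move=> j j' [/ffunP/(_ (cast_ord (esym k_eq) ord0))]; rewrite !ffunE.
have := cardC [pred c : option {ffun 'I_k -> 'I_l} | admissible c].
rewrite card_option card_ffun !card_ord.
have -> : #|[predC [pred c : option {ffun 'I_k -> 'I_l} | admissible c]]| = l.
  rewrite -[RHS]card_ord -(card_codom cst_inj); apply: eq_card => -[f|]; last first.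
    by rewrite !inE /=; apply/esym/negP => /codomP[].
  rewrite !inE /=; apply/idP/codomP => [|[j [->]]].
    rewrite negb_forall => /existsP[j]; rewrite negb_exists => /forallP fj.
    by exists j; congr Some; apply/ffunP => i; rewrite ffunE; apply/eqP/negPn/fj.
  rewrite negb_forall; apply/existsP; exists j.
  by rewrite negb_exists; apply/forallP => i; rewrite ffunE eqxx.
move=> card_eq; have: (l <= l ^ k)%N.
  case: (l) => // m; rewrite k_eq expnS leq_pmulr // expn_gt0 //.
by move=> le; apply/eqP; rewrite -(eqn_add2r l) card_eq addnAC subnK // addn1.
Qed.

Local Close Scope ring_scope.

Theorem corollary2p7 (K : fieldType) (k l d : nat)
    (hk : 2 <= k) (hkl : k <= l) (hld : l <= d) :
  (minimal_primes (radical (J_Delta K k l d)) #= `I_(l ^ k - l + 1))%card.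
Proof.
have k_gt0 : (0 < k)%N by apply: ltnW.
have l_gt1 : (1 < l)%N by apply: leq_trans hkl.
have l_gt0 : (0 < l)%N by apply: ltnW.
pose C := {c : option {ffun 'I_k -> 'I_l} | admissible c}.
pose P (c : C) := @component K k l d (val c).
have P_antichain c c' : (P c `<=` P c')%classic -> c = c'.
  move=> PcPc'; apply/val_inj/(component_antichain k_gt0 _ (valP c) (valP c') PcPc').
  by rewrite l_gt1.
rewrite (@minimal_primes_radical_range _ _ C P) //.
- rewrite -(card_admissible l k_gt0); apply: card_range_fin => c c' PcPc'.
  by apply: P_antichain; rewrite PcPc'.
- by move=> c; apply: component_prime.
- by move=> c; apply: J_Delta_sub_component.
- move=> q q_prime /(component_below l_gt0 q_prime)[c [c_adm cq]].
  by exists (exist _ c c_adm).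
Qed.
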